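(* Let $R$ be a domain and let $S$ be a left Ore set in $R$. Then $\operatorname{LSat}(S)$ is a left Ore set in $R$, and $S^{-1}R\cong\operatorname{LSat}(S)^{-1}R$ (as rings).
   Context: Rings are unital and not necessarily commutative; a domain is a nonzero ring without zero divisors. A subset $S\subseteq R$ is multiplicatively closed if $1\in S$, $0\notin S$ and $st\in S$ for all $s,t\in S$. It is a left Ore set if it is multiplicatively closed and satisfies the left Ore condition: for all $s\in S$, $r\in R$ there exist $\tilde s\in S$, $\tilde r\in R$ with $\tilde s r=\tilde r s$. For a left Ore set $S$, $S^{-1}R$ denotes the left Ore localization of $R$ at $S$, i.e. the ring of left fractions $(s,r)=s^{-1}r$ with $s\in S$, $r\in R$, where $(s_1,r_1)=(s_2,r_2)$ iff there exist $\tilde s\in S$, $\tilde r\in R$ with $\tilde s s_2=\tilde r s_1$ and $\tilde s r_2=\tilde r r_1$; $R$ embeds via $r\mapsto(1,r)$, elements of $S$ become units. The left saturation closure of a multiplicatively closed set $S$ is $\operatorname{LSat}(S)=\{r\in R\mid\exists w\in R: wr\in S\}$. *)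

(* Defs.v *)
From HB Require Import structures.
From mathcomp Require Import all_boot all_order all_algebra.
From mathcomp Require Import boolp classical_sets.

Set Implicit Arguments.
Unset Strict Implicit.
Unset Printing Implicit Defensive.

Import GRing.Theory.

Local Open Scope ring_scope.
Local Open Scope quotient_scope.

Definition mult_closed (R : nzRingType) (S : set R) : Prop :=
  [/\ S 1, ~ S 0 & forall s t, S s -> S t -> S (s * t)].

Definition left_Ore_condition (R : nzRingType) (S : set R) : Prop :=
  forall s r : R, S s -> exists s' r' : R, S s' /\ s' * r = r' * s.

Definition left_Ore_set (R : nzRingType) (S : set R) : Prop :=
  mult_closed S /\ left_Ore_condition S.

Definition LSat (R : nzRingType) (S : set R) : set R :=
  [set r | exists w : R, S (w * r)].

(* A pair (s, r) with s in S; the membership proof is boolean so that the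
   pairs form a subType of R * R. *)
Definition lfraction (R : nzRingType) (S : set R) : Type :=
  {p : R * R | `[< S p.1 >]}.

HB.instance Definition _ (R : nzRingType) (S : set R) :=
  Choice.on (lfraction S).

Section LeftOreLocalization.

Variables (R : nzRingType) (domR : GRing.integral_domain_axiom R).
Variables (S : set R) (oreS : left_Ore_set S).

Implicit Types p q : lfraction S.

Definition den p : R := (val p).1.
Definition num p : R := (val p).2.

Lemma denP p : S (den p). Proof. exact/asboolP/(valP p). Qed.

Definition mklfrac (s r : R) (Ss : S s) : lfraction S :=
  exist _ (s, r) (asboolT (Ss : S (s, r).1)).

Definition lfrac_eq p q : Prop :=
  exists s' r' : R,
    [/\ S s', s' * den q = r' * den p & s' * num q = r' * num p].

Let S1 : S 1. Proof. by case: oreS => -[]. Qed.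
Let S0 : ~ S 0. Proof. by case: oreS => -[]. Qed.
Let SM s t : S s -> S t -> S (s * t).
Proof. by case: oreS => -[_ _ + _]; apply. Qed.
Let Sore : left_Ore_condition S. Proof. by case: oreS. Qed.

Let S_neq0 s : S s -> s != 0.
Proof. by move=> Ss; apply/eqP => s0; apply: S0; rewrite -s0. Qed.

Let mul_neq0 (x y : R) : x != 0 -> y != 0 -> x * y != 0.
Proof.
by move=> x0 y0; apply/negP => /eqP /domR; rewrite (negPf x0) (negPf y0).
Qed.

Let cancelL (x y z : R) : x != 0 -> x * y = x * z -> y = z.
Proof.
move=> x0 /eqP; rewrite -subr_eq0 -mulrBr => /eqP /domR.
by rewrite (negPf x0) subr_eq0 => /eqP.
Qed.

Let cancelR (x y z : R) : x != 0 -> y * x = z * x -> y = z.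
Proof.
move=> x0 /eqP; rewrite -subr_eq0 -mulrBl => /eqP /domR.
by rewrite (negPf x0) orbF subr_eq0 => /eqP.
Qed.

(* Two left multiples of elements of S have a nonzero common left multiple. *)
Let common_mul (x s : R) : x != 0 -> S s ->
  exists u v : R, [/\ u != 0, v != 0 & u * x = v * s].
Proof.
move=> x0 Ss; have [u [v [Su E]]] := Sore x Ss; exists u, v.
split; [exact: S_neq0 | apply/eqP => v0 | by []].
by move: (mul_neq0 (S_neq0 Su) x0); rewrite E v0 mul0r eqxx.
Qed.

Let lfrac_eq_elim p q (a b : R) :
  lfrac_eq p q -> a * den p = b * den q -> a * num p = b * num q.
Proof.
move=> [b0 [a0 [Sb0 Ed En]]] E.
have [u [v [Su Euv]]] := Sore b (Sb0).
have Ea : u * a = v * a0.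
  apply: (cancelR (S_neq0 (denP p))).
  by rewrite -!mulrA E -Ed !mulrA Euv.
by apply: (cancelL (S_neq0 Su)); rewrite !mulrA Ea Euv -!mulrA En.
Qed.

Let lfrac_eq_intro p q (a b : R) : a != 0 ->
  a * den p = b * den q -> a * num p = b * num q -> lfrac_eq p q.
Proof.
move=> a0 Ed En.
have [c [d [Sc Ecd]]] := Sore (den q) (denP p).
have b0 : b != 0.
  by apply/eqP => b0; move: (mul_neq0 a0 (S_neq0 (denP p)));
    rewrite Ed b0 mul0r eqxx.
have [u [v [u0 v0 Euv]]] := common_mul b0 Sc.
exists c, d; split=> //; apply: (cancelL v0).
have -> : v * (d * num p) = u * (a * num p).
  rewrite !mulrA; congr (_ * _); apply: (cancelR (S_neq0 (denP p))).
  by rewrite -!mulrA -Ecd Ed !mulrA Euv.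
by rewrite En !mulrA Euv.
Qed.

Let lfrac_eqb p q : bool := `[< lfrac_eq p q >].

Let lfrac_eqb_refl : reflexive lfrac_eqb.
Proof. by move=> p; apply/asboolP; exists 1, 1. Qed.

Let lfrac_eq_sym p q : lfrac_eq p q -> lfrac_eq q p.
Proof.
case=> b [a [Sb Ed En]].
by apply: (@lfrac_eq_intro q p b a) => //; exact: S_neq0.
Qed.

Let lfrac_eqb_sym : symmetric lfrac_eqb.
Proof. by move=> p q; apply/asboolP/asboolP; exact: lfrac_eq_sym. Qed.

Let lfrac_eqb_trans : transitive lfrac_eqb.
Proof.
move=> q p t /asboolP Epq /asboolP Eqt; apply/asboolP.
have [b [a [Sb Ed En]]] := Epq.
have bq0 : b * den q != 0 by apply: mul_neq0; apply: S_neq0 => //; exact: denP.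
have [u [v [u0 v0 Euv]]] := common_mul bq0 (denP t).
have Euv' : (u * a) * den p = v * den t by rewrite -mulrA -Ed.
apply: (@lfrac_eq_intro _ _ (u * a) v) => //.
  apply: mul_neq0 => //; apply/eqP => a0.
  by move: bq0; rewrite Ed a0 mul0r eqxx.
rewrite -mulrA -En mulrA.
by apply: lfrac_eq_elim Eqt _; rewrite -mulrA.
Qed.

Canonical lfrac_equiv : equiv_rel (lfraction S) :=
  EquivRel lfrac_eqb lfrac_eqb_refl lfrac_eqb_sym lfrac_eqb_trans.

Definition lOre_loc : Type := {eq_quot lfrac_equiv}.

HB.instance Definition _ := Choice.on lOre_loc.
HB.instance Definition _ := EqQuotient.on lOre_loc.

Definition lfrac (s r : R) (Ss : S s) : lOre_loc :=
  \pi_lOre_loc (mklfrac r Ss).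

Lemma lfrac_eqE (s1 r1 s2 r2 : R) (Ss1 : S s1) (Ss2 : S s2) :
  lfrac r1 Ss1 = lfrac r2 Ss2 <->
  exists s' r' : R, [/\ S s', s' * s2 = r' * s1 & s' * r2 = r' * r1].
Proof.
split; first by move=> /eqquotP /asboolP.
by move=> E; apply/eqquotP/asboolP.
Qed.

Lemma lfracP (x : lOre_loc) : exists s r (Ss : S s), x = lfrac r Ss.
Proof.
elim/quotW: x => p; exists (den p), (num p), (denP p).
by apply/eqquotP/asboolP; exists 1, 1.
Qed.

Let reprE (s r : R) (Ss : S s) (a b : R) :
  a * den (repr (lfrac r Ss)) = b * s -> a * num (repr (lfrac r Ss)) = b * r.
Proof.
move=> E; apply: (@lfrac_eq_elim (repr (lfrac r Ss)) (mklfrac r Ss)) => //.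
by apply/asboolP/(@eqquotP _ lfrac_equiv lOre_loc); rewrite reprK.
Qed.

Let lfrac_intro (s1 r1 s2 r2 : R) (Ss1 : S s1) (Ss2 : S s2) (a b : R) :
  a != 0 -> a * s1 = b * s2 -> a * r1 = b * r2 -> lfrac r1 Ss1 = lfrac r2 Ss2.
Proof.
move=> a0 Ed En; apply/eqquotP/asboolP.
exact: (@lfrac_eq_intro _ _ a b).
Qed.

Let oreW (s r : R) (Ss : S s) : {c : R * R | S c.1 /\ c.1 * r = c.2 * s}.
Proof. by apply: cid; have [a [b ?]] := Sore r Ss; exists (a, b). Qed.

(* (s1, r1) + (s2, r2) = (a s1, a r1 + b r2) where a s1 = b s2, a in S *)
Definition loc_add (x y : lOre_loc) : lOre_loc :=
  let: p := repr x in let: q := repr y in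
  let: exist c (conj Sc _) := oreW (den p) (denP q) in
  lfrac (c.1 * num p + c.2 * num q) (SM Sc (denP p)).

(* (s1, r1) * (s2, r2) = (a s1, b r2) where a r1 = b s2, a in S *)
Definition loc_mul (x y : lOre_loc) : lOre_loc :=
  let: p := repr x in let: q := repr y in
  let: exist c (conj Sc _) := oreW (num p) (denP q) in
  lfrac (c.2 * num q) (SM Sc (denP p)).

Definition loc_opp (x : lOre_loc) : lOre_loc :=
  lfrac (- num (repr x)) (denP (repr x)).

Definition loc_zero : lOre_loc := lfrac 0 S1.
Definition loc_one : lOre_loc := lfrac 1 S1.

Lemma loc_addE (s1 r1 s2 r2 a b : R) (Ss1 : S s1) (Ss2 : S s2)
    (Sas : S (a * s1)) :
  a * s1 = b * s2 ->
  loc_add (lfrac r1 Ss1) (lfrac r2 Ss2) = lfrac (a * r1 + b * r2) Sas.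
Proof.
move=> E; rewrite /loc_add; case: oreW => -[c d] /= [Sc Ecd].
have cp0 := S_neq0 (SM Sc (denP (repr (lfrac r1 Ss1)))).
have [u [v [u0 v0 Euv]]] := common_mul cp0 Sas.
apply: (@lfrac_intro _ _ _ _ _ _ u v) => //.
rewrite !mulrDr !mulrA; congr (_ + _); apply: reprE; first by rewrite -!mulrA.
by rewrite -!mulrA -Ecd -E.
Qed.

Lemma loc_mulE (s1 r1 s2 r2 a b : R) (Ss1 : S s1) (Ss2 : S s2)
    (Sas : S (a * s1)) :
  a * r1 = b * s2 ->
  loc_mul (lfrac r1 Ss1) (lfrac r2 Ss2) = lfrac (b * r2) Sas.
Proof.
move=> E; rewrite /loc_mul; case: oreW => -[c d] /= [Sc Ecd].
have cp0 := S_neq0 (SM Sc (denP (repr (lfrac r1 Ss1)))).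
have [u [v [u0 v0 Euv]]] := common_mul cp0 Sas.
apply: (@lfrac_intro _ _ _ _ _ _ u v) => //.
rewrite !mulrA; apply: reprE.
rewrite -!mulrA -Ecd -E !mulrA; apply: reprE.
by rewrite -!mulrA.
Qed.

Let lfrac_expand (s r a : R) (Ss : S s) (Sas : S (a * s)) :
  lfrac r Ss = lfrac (a * r) Sas.
Proof.
apply: (@lfrac_intro _ _ _ _ _ _ a 1); rewrite ?mul1r //.
by apply/eqP => a0; apply: S0; rewrite -(mul0r s) -a0.
Qed.

Let lfrac_congr (s s' r r' : R) (Ss : S s) (Ss' : S s') :
  s = s' -> r = r' -> lfrac r Ss = lfrac r' Ss'.
Proof.
by move=> E F; apply: (@lfrac_intro _ _ _ _ _ _ 1 1); rewrite ?oner_neq0 ?E ?F.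
Qed.

Lemma loc_oppE (s r : R) (Ss : S s) : loc_opp (lfrac r Ss) = lfrac (- r) Ss.
Proof.
have [u [v [u0 v0 Euv]]] :=
  common_mul (S_neq0 (denP (repr (lfrac r Ss)))) Ss.
apply: (@lfrac_intro _ _ _ _ _ _ u v) => //.
by rewrite !mulrN; congr (- _); apply: reprE.
Qed.

Let loc_addE1 (s r1 r2 : R) (Ss Ss' : S s) :
  loc_add (lfrac r1 Ss) (lfrac r2 Ss') = lfrac (r1 + r2) Ss.
Proof.
have Ss1 : S (1 * s) by rewrite mul1r.
by rewrite (@loc_addE _ _ _ _ 1 1 _ _ Ss1) //;
  apply: lfrac_congr; rewrite !mul1r.
Qed.

Let lfrac2P (x y : lOre_loc) : exists s r1 r2 (Ss : S s),
  x = lfrac r1 Ss /\ y = lfrac r2 Ss.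
Proof.
have [s1 [r1 [Ss1 ->]]] := lfracP x; have [s2 [r2 [Ss2 ->]]] := lfracP y.
have [a [b [Sa E]]] := Sore s1 Ss2.
have Sas := SM Sa Ss1; have Sbs : S (b * s2) by rewrite -E.
exists (a * s1), (a * r1), (b * r2), Sas; split; first exact: lfrac_expand.
by rewrite (lfrac_expand r2 Ss2 Sbs); apply: lfrac_congr.
Qed.

Let lfrac3P (x y z : lOre_loc) : exists s r1 r2 r3 (Ss : S s),
  [/\ x = lfrac r1 Ss, y = lfrac r2 Ss & z = lfrac r3 Ss].
Proof.
have [s1 [r1 [r2 [Ss1 [-> ->]]]]] := lfrac2P x y.
have [s2 [r3 [Ss2 ->]]] := lfracP z.
have [a [b [Sa E]]] := Sore s1 Ss2.
have Sas := SM Sa Ss1; have Sbs : S (b * s2) by rewrite -E.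
exists (a * s1), (a * r1), (a * r2), (b * r3), Sas; split.
- exact: lfrac_expand.
- exact: lfrac_expand.
- by rewrite (lfrac_expand r3 Ss2 Sbs); apply: lfrac_congr.
Qed.

Let loc_addA : associative loc_add.
Proof.
move=> x y z; have [s [r1 [r2 [r3 [Ss [-> -> ->]]]]]] := lfrac3P x y z.
by rewrite !loc_addE1 addrA.
Qed.

Let loc_addC : commutative loc_add.
Proof.
move=> x y; have [s [r1 [r2 [Ss [-> ->]]]]] := lfrac2P x y.
by rewrite !loc_addE1 addrC.
Qed.

Let loc_zeroE (s : R) (Ss : S s) : loc_zero = lfrac 0 Ss.
Proof.
apply: (@lfrac_intro _ _ _ _ _ _ s 1); rewrite ?mulr0 ?mulr1 ?mul1r //.
exact: S_neq0.
Qed.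

Let loc_oneE (s : R) (Ss : S s) : loc_one = lfrac s Ss.
Proof.
apply: (@lfrac_intro _ _ _ _ _ _ s 1); rewrite ?mulr1 ?mul1r //.
exact: S_neq0.
Qed.

Let loc_add0 : left_id loc_zero loc_add.
Proof.
by move=> x; have [s [r [Ss ->]]] := lfracP x; rewrite (loc_zeroE Ss) loc_addE1 add0r.
Qed.

Let loc_addN : left_inverse loc_zero loc_opp loc_add.
Proof.
move=> x; have [s [r [Ss ->]]] := lfracP x.
by rewrite (loc_zeroE Ss) loc_oppE loc_addE1 addNr.
Qed.

Let loc_mulA : associative loc_mul.
Proof.
move=> x y z; have [s1 [r1 [Ss1 ->]]] := lfracP x.
have [s2 [r2 [Ss2 ->]]] := lfracP y; have [s3 [r3 [Ss3 ->]]] := lfracP z.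
have [c [d [Sc Ecd]]] := Sore r2 Ss3.
have Scs := SM Sc Ss2.
have [a [b [Sa Eab]]] := Sore r1 Scs.
have Sas := SM Sa Ss1; have Sas1 : S (1 * (a * s1)) by rewrite mul1r.
rewrite (@loc_mulE _ r2 _ r3 c d _ _ Scs) // (@loc_mulE _ r1 _ _ a b _ _ Sas) //.
rewrite (@loc_mulE _ r1 _ r2 a (b * c) _ _ Sas) -?mulrA //.
rewrite (@loc_mulE _ _ _ r3 1 (b * d) _ _ Sas1); last first.
  by rewrite mul1r -!mulrA Ecd.
by apply: lfrac_congr; rewrite ?mul1r ?mulrA.
Qed.

Let loc_mul1x : left_id loc_one loc_mul.
Proof.
move=> x; have [s [r [Ss ->]]] := lfracP x.
have Ss1 : S (1 * s) by rewrite mul1r.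
rewrite (loc_oneE Ss) (@loc_mulE _ _ _ _ 1 1 _ _ Ss1) //.
Qed.

Let loc_mulx1 : right_id loc_one loc_mul.
Proof.
move=> x; have [s [r [Ss ->]]] := lfracP x.
have Ss1 : S (1 * s) by rewrite mul1r.
rewrite (@loc_mulE _ _ _ _ 1 r _ _ Ss1); last by rewrite mul1r mulr1.
by apply: lfrac_congr; rewrite ?mul1r ?mulr1.
Qed.

Let loc_mulDl : left_distributive loc_mul loc_add.
Proof.
move=> y z x; have [t [y1 [y2 [St [-> ->]]]]] := lfrac2P y z.
have [s [r [Ss ->]]] := lfracP x.
have [a [b [Sa E1]]] := Sore y1 Ss.
have [c [d [Sc E2]]] := Sore (a * y2) Ss.
have Sct := SM (SM Sc Sa) St.
rewrite loc_addE1 (@loc_mulE _ y1 _ r (c * a) (c * b) _ _ Sct); last first.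
  by rewrite -!mulrA E1.
rewrite (@loc_mulE _ y2 _ r (c * a) d _ _ Sct) -?mulrA // loc_addE1.
rewrite (@loc_mulE _ _ _ r (c * a) (c * b + d) _ _ Sct) ?mulrDl //.
by rewrite mulrDr -!mulrA E1 E2.
Qed.

Let loc_mulDr : right_distributive loc_mul loc_add.
Proof.
move=> x y z; have [t [y1 [y2 [St [-> ->]]]]] := lfrac2P y z.
have [s [r [Ss ->]]] := lfracP x.
have [a [b [Sa E]]] := Sore r St.
have Sas := SM Sa Ss.
by rewrite loc_addE1 !(@loc_mulE _ _ _ _ a b _ _ Sas) // loc_addE1 mulrDr.
Qed.

Let loc_one_neq0 : loc_one != loc_zero.
Proof.
apply/eqP => /lfrac_eqE [s' [r' [Ss']]].
by rewrite mulr0 !mulr1 => <- s'0; apply: S0; rewrite s'0.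
Qed.

HB.instance Definition _ := GRing.isNzRing.Build lOre_loc
  loc_addA loc_addC loc_add0 loc_addN loc_mulA loc_mul1x loc_mulx1
  loc_mulDl loc_mulDr loc_one_neq0.

End LeftOreLocalization.

(* Main.v *)
Require Import Defs.
From HB Require Import structures.
From mathcomp Require Import all_boot all_order all_algebra.
From mathcomp Require Import boolp classical_sets.

Import GRing.Theory.

Local Open Scope ring_scope.
Local Open Scope quotient_scope.
Local Open Scope classical_set_scope.

(** For Ore sets [S `<=` T], reading a fraction over [S] as a fraction over [T]
    is a ring morphism. When every [t] in [T] has a left multiple [w * t] in
    [S], it is injective because a witness [s'] in [T] of an equality of
    fractions can be replaced by [w * s'] in [S], and surjective because
    [t^-1 r = (w t)^-1 (w r)]. *)

Lemma sub_LSat (R : nzRingType) (S : set R) : S `<=` LSat S.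
Proof. by move=> s Ss; exists 1; rewrite mul1r. Qed.

Lemma LSat_mult_closed (R : nzRingType) (S : set R) :
  left_Ore_set S -> mult_closed (LSat S).
Proof.
move=> [[S1 S0 SM] oreS]; split.
- exact/sub_LSat.
- by case=> w; rewrite mulr0.
- move=> r t [w Swr] [v Svt].
  (* The Ore condition moves [v] past [w * r]: from [s' * v = r' * (w * r)] follows
     [r' * w * (r * t) = s' * (v * t)], a product in [S]. *)
  have [s' [r' [Ss' E]]] := oreS _ v Swr.
  by exists (r' * w); rewrite mulrA -(mulrA r') -E -mulrA; apply: SM.
Qed.

Lemma LSat_Ore (R : nzRingType) (S : set R) :
  left_Ore_set S -> left_Ore_set (LSat S).
Proof.
move=> oreS; split; first exact: LSat_mult_closed.
move=> s r [w Sws]; case: oreS => _ oreS.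
have [s' [r' [Ss' E]]] := oreS _ r Sws.
by exists s', (r' * w); rewrite -mulrA; split; first exact: sub_LSat.
Qed.

Section LocalizationMap.

Context {R : nzRingType} (domR : GRing.integral_domain_axiom R).
Context {S T : set R} (oreS : left_Ore_set S) (oreT : left_Ore_set T).
Hypothesis subST : S `<=` T.

Definition lOre_map (x : lOre_loc domR oreS) : lOre_loc domR oreT :=
  lfrac domR oreT (num (repr x)) (subST _ (denP (repr x))).

(** Frees [lOre_map] from the chosen representative: a witness in [S] of an equality of fractions is
    also one in [T]. *)
Lemma lOre_mapE (s r : R) (Ss : S s) (Ts : T s) :
  lOre_map (lfrac domR oreS r Ss) = lfrac domR oreT r Ts.
Proof.
set x := lfrac domR oreS r Ss.
have E : lfrac domR oreS (num (repr x)) (denP (repr x)) = x.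
  rewrite -[RHS]reprK; apply/eqquotP/asboolP.
  by exists 1, 1; split=> //; case: oreS => -[].
have /lfrac_eqE[s' [r' [Ss' Ed En]]] := E.
by apply/lfrac_eqE; exists s', r'; split=> //; apply: subST.
Qed.

Lemma common_denominator (x y : lOre_loc domR oreS) :
  exists s r1 r2 (Ss : S s),
    x = lfrac domR oreS r1 Ss /\ y = lfrac domR oreS r2 Ss.
Proof.
have [[S1 _ SM] Sore] := oreS.
have [s1 [r1 [Ss1 ->]]] := lfracP x; have [s2 [r2 [Ss2 ->]]] := lfracP y.
have [a [b [Sa E]]] := Sore _ s1 Ss2.
exists (a * s1), (a * r1), (b * r2), (SM _ _ Sa Ss1).
split; apply/lfrac_eqE; first by exists 1, a; rewrite !mul1r.
by exists 1, b; rewrite !mul1r.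
Qed.

Lemma lOre_map_is_zmod_morphism : zmod_morphism lOre_map.
Proof.
(* Stated for any [U] because it serves on both sides, over [S] and over [T]. *)
have subE (U : set R) (oreU : left_Ore_set U) (s r1 r2 : R) (Us : U s) :
    lfrac domR oreU r1 Us - lfrac domR oreU r2 Us =
    lfrac domR oreU (r1 - r2) Us.
  have U1s : U (1 * s) by rewrite mul1r.
  rewrite [- _]loc_oppE [LHS](loc_addE _ _ _ _ _ _ U1s (erefl (1 * s))) ?mul1r//.
  apply/lfrac_eqE; exists 1, 1; rewrite !mul1r; split=> //.
  by case: oreU => -[].
move=> x y; have [s [r1 [r2 [Ss [-> ->]]]]] := common_denominator x y.
by rewrite subE !(lOre_mapE _ _ _ (subST _ Ss)) subE.
Qed.

Lemma lOre_map_is_monoid_morphism : monoid_morphism lOre_map.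
Proof.
split; first exact: lOre_mapE.
move=> x y; have [[_ _ SM] Sore] := oreS.
have [s1 [r1 [Ss1 ->]]] := lfracP x; have [s2 [r2 [Ss2 ->]]] := lfracP y.
(* As [loc_mulE] accepts any Ore witnesses, this one pair [a], [b] computes the product in both
   localizations. *)
have [a [b [Sa E]]] := Sore _ r1 Ss2.
have Sas := SM _ _ Sa Ss1.
rewrite [in LHS]/GRing.mul /= (loc_mulE _ _ _ _ _ Sas E).
rewrite (lOre_mapE _ _ _ (subST _ Sas)) (lOre_mapE _ _ _ (subST _ Ss1)).
rewrite (lOre_mapE _ _ _ (subST _ Ss2)).
by rewrite [RHS](loc_mulE _ _ _ _ _ (subST _ Sas) E).
Qed.

HB.instance Definition _ := GRing.isZmodMorphism.Build _ _ lOre_map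
  lOre_map_is_zmod_morphism.
HB.instance Definition _ := GRing.isMonoidMorphism.Build _ _ lOre_map
  lOre_map_is_monoid_morphism.

Hypothesis subT_LSat : T `<=` LSat S.

Lemma lOre_map_inj : injective lOre_map.
Proof.
move=> x y; have [s1 [r1 [Ss1 ->]]] := lfracP x.
have [s2 [r2 [Ss2 ->]]] := lfracP y.
rewrite (lOre_mapE _ _ _ (subST _ Ss1)) (lOre_mapE _ _ _ (subST _ Ss2)).
move=> /lfrac_eqE[s' [r' [/subT_LSat[w Sws'] Ed En]]].
by apply/lfrac_eqE; exists (w * s'), (w * r'); rewrite -!mulrA Ed En.
Qed.

Lemma lOre_map_surj (y : lOre_loc domR oreT) : exists x, lOre_map x = y.
Proof.
have [t [r [Tt ->]]] := lfracP y; have [w Swt] := subT_LSat _ Tt.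
exists (lfrac domR oreS (w * r) Swt); rewrite (lOre_mapE _ _ _ (subST _ Swt)).
(* The symmetry puts [w] in the position of the multiplier that may be any element of [R]; the one
   that must lie in [T] is [1]. *)
apply/esym/lfrac_eqE; exists 1, w; rewrite !mul1r; split=> //.
by case: oreT => -[].
Qed.

Lemma lOre_map_bij : bijective lOre_map.
Proof.
(* Choice turns surjectivity into a right inverse [g]; injectivity makes it a left inverse as
   well. *)
have [g gK] := choice lOre_map_surj.
by exists g => // x; apply: lOre_map_inj; rewrite gK.
Qed.

End LocalizationMap.

Theorem proposition2p7 (R : nzRingType)
  (domR : GRing.integral_domain_axiom R)
  (S : set R) (oreS : left_Ore_set S) :
  exists oreL : left_Ore_set (LSat S),
  exists f : {rmorphism lOre_loc domR oreS -> lOre_loc domR oreL},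
    bijective f.
Proof.
exists (LSat_Ore _ _ oreS), (lOre_map domR oreS (LSat_Ore _ _ oreS) (sub_LSat _ _)).
(* For [T] equal to [LSat S], the hypothesis [subT_LSat] is a trivial inclusion. *)
exact: lOre_map_bij.
Qed.
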